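(* Let $k$ be an algebraically closed field of arbitrary characteristic, $S=k[[\alpha_1,\dots,\alpha_n]]$ with maximal ideal $\mathfrak m$, and let $f\in P$. Then $\mathfrak g^+f=\mathfrak m f+\sum_{i=1}^n\mathfrak m^2(x_i f)$, so that $$(\mathfrak g^+f)^\perp=\{\sigma\in S\mid \deg(\sigma\lrcorner f)\le 0,\ \forall_i\ \deg(\sigma^{(i)}\lrcorner f)\le 1\}.$$ If $f$ is homogeneous of degree $d$, then $\mathfrak g^+f$ is spanned by homogeneous polynomials and $$(\mathfrak g^+f)^\perp_{<d}=\{\sigma\in S_{<d}\mid\sigma\lrcorner f=0,\ \forall_i\ \sigma^{(i)}\lrcorner f=0\}=(\mathfrak g f)^\perp_{<d}.$$
   Context: $P$ is the space of $k$-linear functionals on $S$ vanishing on some power of $\mathfrak m$; pairing $\langle-,-\rangle:S\times P\to k$. It has a basis $\mathbf x^{[\mathbf a]}$ ($\mathbf a\in\mathbb N_0^n$, of degree $\sum a_i$) dual to the monomials $\alpha^{\mathbf a}$, $x_i$ is dual to $\alpha_i$, and $P$ is a divided power ring with $\mathbf x^{[\mathbf a]}\cdot\mathbf x^{[\mathbf b]}=\prod_i\binom{a_i+b_i}{a_i}\mathbf x^{[\mathbf a+\mathbf b]}$. $S$ acts on $P$ by contraction: $\langle\tau,\sigma\lrcorner f\rangle=\langle\tau\sigma,f\rangle$. For an ideal $J\subseteq S$ and $g\in P$, $Jg=\{\sigma\lrcorner g:\sigma\in J\}$. $\mathfrak{aut}$ (resp. $\mathfrak{aut}^+$) is the space of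 $k$-linear derivations $D:S\to S$ with $D(\mathfrak m)\subseteq\mathfrak m$ (resp. $D(\mathfrak m)\subseteq\mathfrak m^2$). Inside the space of linear maps $S\to S$, viewing $\sigma\in S$ as multiplication by $\sigma$, put $\mathfrak g=\mathfrak{aut}+S$ and $\mathfrak g^+=\mathfrak{aut}^++\mathfrak m$. An element $L$ of $\mathfrak g$ acts on $P$ by the dual map $L^\vee$, $\langle\tau,L^\vee(f)\rangle=\langle L(\tau),f\rangle$, and $\mathfrak g f=\{L^\vee(f):L\in\mathfrak g\}$, $\mathfrak g^+f=\{L^\vee(f):L\in\mathfrak g^+\}$. For a subspace $W\subseteq P$, $W^\perp=\{\sigma\in S:\langle\sigma,w\rangle=0\ \forall w\in W\}$. $\sigma^{(i)}$ is the $i$-th partial derivative of $\sigma$. By convention $\deg(0)<0$. $S_{<d}$ is the space of polynomials in the $\alpha_i$ of degree less than $d$, and $V_{<d}=V\cap S_{<d}$ for $V\subseteq S$. *)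

(* Defs.v *)
From HB Require Import structures.
From mathcomp Require Export all_boot all_order all_algebra.
From mathcomp Require Export mpoly.
From mathcomp Require Export boolp classical_sets functions.

Set Implicit Arguments.
Unset Strict Implicit.
Unset Printing Implicit Defensive.

Import Order.TTheory GRing.Theory Num.Theory.

Local Open Scope classical_set_scope.
Local Open Scope ring_scope.

(* A power series is the family of its coefficients; the type is a record
   (not an alias of the function type) so that functions' pointwise product
   cannot be inferred for it. *)
Record mpseries (n : nat) (k : Type) := MPSeries { mpsval :> 'X_{1..n} -> k }.

HB.instance Definition _ (n : nat) (k : Type) := [isNew for @mpsval n k].
HB.instance Definition _ (n : nat) (k : eqType) :=
  [Equality of mpseries n k by <:].
HB.instance Definition _ (n : nat) (k : choiceType) :=
  [Choice of mpseries n k by <:].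

Section PowerSeriesRing.
Variables (n : nat) (k : comNzRingType).
Implicit Types (s t u : mpseries n k) (a b c : 'X_{1..n}).

Lemma mpsP s t : (forall a, s a = t a) -> s = t.
Proof. by case: s t => [s] [t] /= st; congr MPSeries; apply/funext. Qed.

Definition mps_zero : mpseries n k := MPSeries (fun=> 0).
Definition mps_opp s : mpseries n k := MPSeries (fun a => - s a).
Definition mps_add s t : mpseries n k := MPSeries (fun a => s a + t a).

Fact mps_addA : associative mps_add.
Proof. by move=> s t u; apply/mpsP=> a; rewrite /= addrA. Qed.
Fact mps_addC : commutative mps_add.
Proof. by move=> s t; apply/mpsP=> a; rewrite /= addrC. Qed.
Fact mps_add0 : left_id mps_zero mps_add.
Proof. by move=> s; apply/mpsP=> a; rewrite /= add0r. Qed.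
Fact mps_addN : left_inverse mps_zero mps_opp mps_add.
Proof. by move=> s; apply/mpsP=> a; rewrite /= addNr. Qed.

HB.instance Definition _ := GRing.isZmodule.Build (mpseries n k)
  mps_addA mps_addC mps_add0 mps_addN.

Lemma mps0E a : (0 : mpseries n k) a = 0. Proof. by []. Qed.
Lemma mpsDE s t a : (s + t) a = s a + t a. Proof. by []. Qed.
Lemma mpsNE s a : (- s) a = - s a. Proof. by []. Qed.
Lemma mps_sumE (I : Type) (r : seq I) (Q : pred I) (F : I -> mpseries n k) a :
  (\sum_(i <- r | Q i) F i) a = \sum_(i <- r | Q i) F i a.
Proof. by elim/big_rec2: _ => // i x y _ <-. Qed.

(* The monomial [alpha^a]. *)
Definition mps_mon a : mpseries n k := MPSeries (fun b => (b == a)%:R).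

Definition mps_mul s t : mpseries n k := MPSeries (fun c =>
  \sum_(a : 'X_{1..n < (mdeg c).+1} | (a <= c)%MM) s a * t (c - a)%MM).

(* Truncations reduce the ring axioms to those of [{mpoly k[n]}]. *)
Let trunc N s : {mpoly k[n]} := \sum_(a : 'X_{1..n < N}) s a *: 'X_[a].

Let truncE N s a : (mdeg a < N)%N -> (trunc N s)@_a = s a.
Proof. exact: mcoeff_mpoly. Qed.

Let mulE (p q : {mpoly k[n]}) s t c :
  (forall a, (mdeg a <= mdeg c)%N -> p@_a = s a) ->
  (forall a, (mdeg a <= mdeg c)%N -> q@_a = t a) ->
  mps_mul s t c = (p * q)@_c.
Proof.
move=> ps qt; rewrite /= (mcoeff_poly_mul_lin _ _ (ltnSn (mdeg c))).
apply: eq_bigr => a le_ac; rewrite ps ?qt //; last by rewrite -ltnS bmdeg.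
by rewrite mdegB.
Qed.

Let mulT s t c : mps_mul s t c = (trunc (mdeg c).+1 s * trunc (mdeg c).+1 t)@_c.
Proof. by apply: mulE => a le_ac; rewrite truncE. Qed.

Let mulTT s t N a : (mdeg a < N)%N ->
  (trunc N s * trunc N t)@_a = mps_mul s t a.
Proof.
by move=> ltaN; apply/esym/mulE => b le_ba; rewrite truncE ?(leq_ltn_trans le_ba).
Qed.

Definition mps_one : mpseries n k := mps_mon 0%MM.

Fact mps_mulC : commutative mps_mul.
Proof. by move=> s t; apply/mpsP=> c; rewrite !mulT mulrC. Qed.

Fact mps_mulA : associative mps_mul.
Proof.
move=> s t u; apply/mpsP=> c; set N := (mdeg c).+1.
rewrite (@mulE (trunc N s) (trunc N t * trunc N u)); first last.
- by move=> a ?; rewrite mulTT.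
- by move=> a ?; rewrite truncE.
rewrite mulrA (@mulE (trunc N s * trunc N t) (trunc N u)) //.
- by move=> a ?; rewrite mulTT.
- by move=> a ?; rewrite truncE.
Qed.

Fact mps_mul1 : left_id mps_one mps_mul.
Proof.
move=> s; apply/mpsP=> c; rewrite (@mulE 1 (trunc (mdeg c).+1 s)).
- by rewrite mul1r truncE.
- by move=> a _; rewrite mcoeff1.
- by move=> a ?; rewrite truncE.
Qed.

Fact mps_mulDl : left_distributive mps_mul mps_add.
Proof.
move=> s t u; apply/mpsP=> c /=; rewrite -big_split /=.
by apply: eq_bigr => a _; rewrite mulrDl.
Qed.

Fact mps_one_neq0 : mps_one != 0.
Proof.
apply/eqP=> /(congr1 (fun s : mpseries n k => s 0%MM)) /eqP.
by rewrite /= eqxx oner_eq0.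
Qed.

HB.instance Definition _ := GRing.Zmodule_isComNzRing.Build (mpseries n k)
  mps_mulA mps_mulC mps_mul1 mps_mulDl mps_one_neq0.

Lemma mpsME s t c :
  (s * t) c =
  \sum_(a : 'X_{1..n < (mdeg c).+1} | (a <= c)%MM) s a * t (c - a)%MM.
Proof. by []. Qed.

Lemma mps_monM a b : mps_mon a * mps_mon b = mps_mon (a + b)%MM.
Proof.
apply/mpsP=> c; apply: etrans (@mulE 'X_[a] 'X_[b] _ _ _ _ _) _.
- by move=> d _; rewrite mcoeffX eq_sym.
- by move=> d _; rewrite mcoeffX eq_sym.
by rewrite -mpolyXD mcoeffX eq_sym.
Qed.

Definition mps_scale (x : k) s : mpseries n k := MPSeries (fun a => x * s a).

Fact mps_scaleA x y s : mps_scale x (mps_scale y s) = mps_scale (x * y) s.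
Proof. by apply/mpsP=> a; rewrite /= mulrA. Qed.
Fact mps_scale1 : left_id 1 mps_scale.
Proof. by move=> s; apply/mpsP=> a; rewrite /= mul1r. Qed.
Fact mps_scaleDr : right_distributive mps_scale +%R.
Proof. by move=> x s t; apply/mpsP=> a; rewrite /= mulrDr. Qed.
Fact mps_scaleDl s : {morph mps_scale^~ s : x y / x + y}.
Proof. by move=> x y; apply/mpsP=> a; rewrite /= mulrDl. Qed.

HB.instance Definition _ := GRing.Zmodule_isLmodule.Build k (mpseries n k)
  mps_scaleA mps_scale1 mps_scaleDr mps_scaleDl.

Lemma mpsZE x s a : (x *: s) a = x * s a. Proof. by []. Qed.

Fact mps_scaleAl x s t : x *: (s * t) = (x *: s) * t.
Proof.
apply/mpsP=> c; rewrite mpsZE !mpsME big_distrr /=.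
by apply: eq_bigr => a _; rewrite mulrA.
Qed.

HB.instance Definition _ := GRing.Lmodule_isLalgebra.Build k (mpseries n k)
  mps_scaleAl.
HB.instance Definition _ := GRing.Lalgebra_isComAlgebra.Build k (mpseries n k).

Definition mps_deriv (i : 'I_n) s : mpseries n k :=
  MPSeries (fun a => (a i).+1%:R * s (a + U_(i))%MM).

(* [S_{<d}]: the polynomials of degree less than [d]. *)
Definition mps_lt (d : nat) : set (mpseries n k) :=
  [set s | forall a, (d <= mdeg a)%N -> s a = 0].

End PowerSeriesRing.

Arguments mps_mon {n k} a.

Section Ideals.
Variable R : comNzRingType.

Definition ideal_mul (I J : set R) : set R :=
  [set x | exists2 r : seq (R * R),
     (forall p, p \in r -> I p.1 /\ J p.2) & x = \sum_(p <- r) p.1 * p.2].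

Fixpoint ideal_pow (I : set R) (N : nat) : set R :=
  if N is N'.+1 then ideal_mul I (ideal_pow I N') else setT.

End Ideals.

Section DividedPowers.
Variables (n : nat) (k : fieldType).
Local Notation S := (mpseries n k).
Implicit Types (s t : S) (a b : 'X_{1..n}).

Definition mfrak : set S := [set s | s 0%MM = 0].

Local Notation "''m^' N" := (ideal_pow mfrak N) (at level 8, N at level 1).

Lemma mfrak_mull s t : mfrak s -> mfrak (s * t).
Proof.
rewrite /mfrak => s0; apply: etrans (mpsME _ _ _) _; rewrite big1 // => a.
move=> /mnm_lepP le_a0; have -> : bmnm a = 0%MM.
  by apply/mnmP=> i; apply/eqP; rewrite mnm0E -leqn0 -(mnm0E i).
by rewrite s0 mul0r.
Qed.

Lemma mpow_mull N s t : 'm^N s -> 'm^N (s * t).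
Proof.
case: N => [//|N] [r rI ->]; exists [seq (p.1 * t, p.2) | p <- r].
  by move=> _ /mapP[p /rI[mp Np] ->]; split=> //; apply: mfrak_mull.
by rewrite big_map mulr_suml; apply: eq_bigr => p _; rewrite mulrAC.
Qed.

Lemma mpow_add N s t : 'm^N s -> 'm^N t -> 'm^N (s + t).
Proof.
case: N => [//|N] [r rI ->] [r' rI' ->]; exists (r ++ r').
  by move=> p; rewrite mem_cat => /orP[/rI|/rI'].
by rewrite big_cat.
Qed.

Lemma mpow0 N : 'm^N 0.
Proof. by case: N => [//|N]; exists [::]; rewrite // big_nil. Qed.

Lemma mpow_sum N (I : eqType) (r : seq I) (F : I -> S) :
  (forall i, i \in r -> 'm^N (F i)) -> 'm^N (\sum_(i <- r) F i).
Proof.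
move=> rF; rewrite big_seq; elim/big_rec: _ => [|i x ir Nx]; first exact: mpow0.
by apply: mpow_add => //; apply: rF.
Qed.

Lemma mpow_anti N M : (N <= M)%N -> 'm^M `<=` 'm^N.
Proof.
move/subnK <-; elim: (M - N)%N => [//|d IHd] s [r rI ->].
by apply: mpow_sum => p /rI[_ Np]; rewrite mulrC; apply/mpow_mull/IHd.
Qed.

Lemma mpow_coef N s a : 'm^N s -> (mdeg a < N)%N -> s a = 0.
Proof.
elim: N s a => [//|N IHN] _ c [r rI ->] ltcN.
rewrite mps_sumE big_seq big1 // => p /rI[mp Np].
rewrite mpsME big1 // => a le_ac.
have [a0|a_neq0] := eqVneq (bmnm a) 0%MM; first by rewrite a0 mp mul0r.
rewrite (IHN p.2) ?mulr0 //; rewrite -(submK le_ac) mdegD ltnS in ltcN.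
by rewrite (leq_trans _ ltcN) // -[X in (X < _)%N]addn0 ltn_add2l lt0n mdeg_eq0.
Qed.

(* [P]: the linear functionals vanishing on some power of the maximal ideal. *)
Definition in_P : pred (S -> k^o) := fun f =>
  `[< linear f /\ exists N, forall s, 'm^N s -> f s = 0 >].

Fact in_P_submod : submod_closed in_P.
Proof.
split=> [|x f g /asboolP[lf [N fN]] /asboolP[lg [M gM]]]; apply/asboolP.
  by split; [move=> y s t; rewrite /= scaler0 addr0 | exists 0%N].
split=> [y s t|].
  by rewrite !fctE /= lf lg !scalerDr !scalerA [x * y]mulrC addrACA.
exists (maxn N M) => s Ns; rewrite !fctE /= fN ?gM ?scaler0 ?addr0 //.
  exact: mpow_anti (leq_maxr _ _) _ Ns.
exact: mpow_anti (leq_maxl _ _) _ Ns.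
Qed.

HB.instance Definition _ :=
  GRing.isSubmodClosed.Build k (S -> k^o) in_P in_P_submod.

Record dpoly := DPoly { dpval : S -> k^o; dpvalP : in_P dpval }.

HB.instance Definition _ := [isSub for dpval].
HB.instance Definition _ := [Choice of dpoly by <:].
HB.instance Definition _ := [SubChoice_isSubLmodule of dpoly by <:].

Definition pairing (s : S) (f : dpoly) : k := dpval f s.
Local Notation "<| s , f |>" := (pairing s f) (at level 0).

Lemma dpolyP (f g : dpoly) : (forall s, <|s, f|> = <|s, g|>) -> f = g.
Proof. by move=> fg; apply/val_inj/funext. Qed.

Lemma pairing_linear (f : dpoly) : linear (pairing^~ f : S -> k^o).
Proof. by case/asboolP: (dpvalP f). Qed.

Lemma pairing_mpow (f : dpoly) : exists N, forall s, 'm^N s -> <|s, f|> = 0.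
Proof. by case/asboolP: (dpvalP f). Qed.

Lemma pairing0 s : <|s, 0|> = 0. Proof. by []. Qed.
Lemma pairingD s f g : <|s, f + g|> = <|s, f|> + <|s, g|>. Proof. by []. Qed.
Lemma pairingZ s x f : <|s, x *: f|> = x * <|s, f|>. Proof. by []. Qed.

Fact contr_proof s (f : dpoly) : in_P (fun t => <|t * s, f|>).
Proof.
apply/asboolP; split=> [x t u|].
  by rewrite mulrDl -scalerAl pairing_linear.
by have [N fN] := pairing_mpow f; exists N => t Nt; apply/fN/mpow_mull.
Qed.
Definition contr s (f : dpoly) : dpoly := DPoly (contr_proof s f).

(* The basis [x^[a]] is dual to the monomials [alpha^a], so the coefficient of
   [x^[a]] in [f] is the value of [f] at [alpha^a]. *)
Definition dpcoef (f : dpoly) a : k := <|mps_mon a, f|>.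

(* [x^[a]], as the functional reading off the coefficient of [alpha^a]. *)
Fact dpmon_proof a : in_P (fun s => s a).
Proof.
apply/asboolP; split=> [x s t|]; first by [].
by exists (mdeg a).+1 => s /mpow_coef ->.
Qed.
Definition dpmon a : dpoly := DPoly (dpmon_proof a).

Definition dpvar (i : 'I_n) : dpoly := dpmon U_(i)%MM.

Lemma mps_mon_mpow a N : (N <= mdeg a)%N -> 'm^N (mps_mon a).
Proof.
elim: N a => [//|N IHN] a ltNa.
have [i ai_gt0] : exists i, (0 < a i)%N.
  apply: contrapT => noi; move: ltNa; rewrite mdegE big1 // => i _.
  by apply/eqP; rewrite -leqn0 leqNgt; apply/negP => ai; apply: noi; exists i.
have le_ia : (U_(i) <= a)%MM by rewrite lep1mP -lt0n.
exists [:: (mps_mon U_(i), mps_mon (a - U_(i))%MM)].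
  move=> p; rewrite inE => /eqP -> /=; split.
    by rewrite /mfrak /= eq_sym -mdeg_eq0 mdeg1.
  by apply: IHN; move: ltNa; rewrite -{1}(submK le_ia) mdegD mdeg1 addn1 ltnS.
by rewrite big_seq1 /= mps_monM addmC submK.
Qed.

Fact dpoly_bounded (f : dpoly) : exists N,
  `[< forall a, (N <= mdeg a)%N -> dpcoef f a = 0 >].
Proof.
have [N fN] := pairing_mpow f; exists N; apply/asboolP => a leNa.
exact/fN/mps_mon_mpow.
Qed.

Definition dpsize (f : dpoly) : nat := ex_minn (dpoly_bounded f).

(* The greatest degree of an [x^[a]] occurring in [f]; [-1] if [f = 0]. *)
Definition dpdeg (f : dpoly) : int := (dpsize f)%:Z - 1.

(* Bilinear extension of [x^[a] x^[b] = prod_i 'C(a_i + b_i, a_i) x^[a+b]]; the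
   coefficients of [f] vanish in all degrees [>= dpsize f]. *)
Definition dpmul (f g : dpoly) : dpoly :=
  \sum_(a : 'X_{1..n < dpsize f}) \sum_(b : 'X_{1..n < dpsize g})
    (dpcoef f a * dpcoef g b * (\prod_i 'C(a i + b i, a i))%:R)
      *: dpmon (a + b)%MM.

Definition dphomog (d : nat) (f : dpoly) : Prop :=
  forall a, dpcoef f a != 0 -> mdeg a = d.

Definition contr_set (J : set S) (f : dpoly) : set dpoly :=
  [set contr s f | s in J].

Definition derivation (D : S -> S) : Prop :=
  linear D /\ forall s t, D (s * t) = s * D t + D s * t.

Definition aut : set (S -> S) :=
  [set D | derivation D /\ D @` mfrak `<=` mfrak].
Definition autp : set (S -> S) :=
  [set D | derivation D /\ D @` mfrak `<=` 'm^2].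

Definition gfrak : set (S -> S) :=
  [set (fun t => D t + s * t) | D in aut & s in setT].
Definition gfrakp : set (S -> S) :=
  [set (fun t => D t + s * t) | D in autp & s in mfrak].

Lemma mpow1 s : mfrak s -> 'm^1 s.
Proof.
move=> ms; exists [:: (s, 1)]; last by rewrite big_seq1 mulr1.
by move=> p; rewrite inE => /eqP ->.
Qed.

Lemma mpow_subm N : 'm^(N.+1) `<=` mfrak.
Proof. by move=> s /mpow_coef; apply; rewrite mdeg0. Qed.

Lemma gfrak_mpow L N : gfrak L -> forall s, 'm^N s -> 'm^N (L s).
Proof.
move=> [D [[linD derD] Dm] [u _ <-]] s Ns; apply: mpow_add; last first.
  by rewrite mulrC; apply: mpow_mull.
have D0 : D 0 = 0 by have := linD 1 0 0; rewrite !scale1r !addr0 => /esym/eqP;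
  rewrite -subr_eq0 addrK => /eqP.
have DD x y : D (x + y) = D x + D y by rewrite -[x]scale1r linD !scale1r.
elim: N s Ns => [//|N IHN] _ [r rI ->].
rewrite (big_morph D DD D0); apply: mpow_sum => p /rI[mp Np].
rewrite derD; apply: mpow_add.
  exists [:: (p.1, D p.2)]; last by rewrite big_seq1.
  by move=> q; rewrite inE => /eqP ->; split=> //; apply: IHN.
exists [:: (D p.1, p.2)]; last by rewrite big_seq1.
by move=> q; rewrite inE => /eqP -> /=; split=> //; apply: Dm; exists p.1.
Qed.

Lemma gfrakp_sub : gfrakp `<=` gfrak.
Proof.
move=> L [D [derD Dm] [s _ <-]]; exists D; last by exists s.
by split=> // t /Dm /mpow_subm.
Qed.

(* [g] is [L^\vee f]; by [dual_exists] and [is_dual_inj] there is exactly one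
   such [g] for each [L] in [gfrak]. *)
Definition is_dual (L : S -> S) (f g : dpoly) : Prop :=
  forall t, <|t, g|> = <|L t, f|>.

Lemma is_dual_inj L f g g' : is_dual L f g -> is_dual L f g' -> g = g'.
Proof. by move=> fg fg'; apply: dpolyP => t; rewrite fg fg'. Qed.

Lemma dual_exists L f : gfrak L -> exists g, is_dual L f g.
Proof.
move=> gL; suff Lf : in_P (fun t => <|L t, f|>) by exists (DPoly Lf).
apply/asboolP; split=> [x s t|].
  case: gL => [D [[linD _] _] [u _ <-]].
  rewrite linD mulrDr addrACA -scalerAr -scalerDr.
  exact: pairing_linear.
by have [N fN] := pairing_mpow f; exists N => s /(gfrak_mpow gL)/fN.
Qed.

Definition act_set (G : set (S -> S)) (f : dpoly) : set dpoly :=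
  [set g | exists2 L, G L & is_dual L f g].

Definition perp (W : set dpoly) : set S :=
  [set s | forall w, W w -> <|s, w|> = 0].

Definition set_add (V W : set dpoly) : set dpoly :=
  [set v + w | v in V & w in W].

Definition set_bigsum (W : 'I_n -> set dpoly) : set dpoly :=
  [set \sum_i w i | w in [set w : 'I_n -> dpoly | forall i, W i (w i)]].

Definition span_set (H : set dpoly) : set dpoly :=
  [set v | exists2 r : seq (k * dpoly),
     (forall p, p \in r -> H p.2) & v = \sum_(p <- r) p.1 *: p.2].
End DividedPowers.

Arguments mfrak {n k}.
Arguments aut {n k}.
Arguments autp {n k}.
Arguments gfrak {n k}.
Arguments gfrakp {n k}.
Arguments dpmon {n k} a.
Arguments dpvar {n k} i.
Arguments mps_lt {n k} d.

(* Main.v *)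
(* A derivation D of S is determined by b_i = D(alpha_i): D = sum_i b_i d_i,
   since a derivation killing the alpha_i kills all monomials and, lowering the
   m-adic order by at most one, all series.  So the elements of g^+ are the
   operators sum_i b_i d_i + s with b_i in m^2 and s in m.  The dual of d_i is
   multiplication by x_i, and x_i (sigma _| f) and sigma _| (x_i f) differ by
   sigma^(i) _| f; as d_i maps m^2 into m, this gives g^+ f = m f + sum m^2 (x_i f).
   Pairing sigma with the duals of u and of u d_i, for u in m and in m^2, yields
   the perp.  When f is homogeneous of degree d and sigma has degree < d, the
   functionals sigma _| f and sigma^(i) _| f also vanish in degree 0 and in
   degrees <= 1 respectively, so they are zero. *)
Require Import Defs.
From mathcomp Require Import all_boot all_order all_algebra.
From mathcomp Require Import mpoly.
From mathcomp Require Import boolp classical_sets functions.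

Local Open Scope classical_set_scope.
Local Open Scope ring_scope.

Set Implicit Arguments.
Unset Strict Implicit.
Unset Printing Implicit Defensive.

Import Order.TTheory GRing.Theory Num.Theory.

Local Notation "''m^' N" := (ideal_pow mfrak N) (at level 8, N at level 1).
Local Notation "<| s , f |>" := (pairing s f) (at level 0).

(** * Powers of [mfrak] as the order filtration, and continuity of linear maps *)

Section OrderFiltration.
Variables (n : nat) (k : fieldType).
Local Notation S := (mpseries n k).
Implicit Types (s t : S) (a b c : 'X_{1..n}).

(* A series without constant term is [\sum_i alpha_i s_i], where [alpha_i s_i]
   collects the monomials whose first variable is [alpha_i]. *)
Lemma mpow_coefP N s :
  (forall a, (mdeg a < N)%N -> s a = 0) -> 'm^N s.
Proof.
elim: N s => [//|N IHN] s s_lt.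
pose q (i : 'I_n) : S := MPSeries (fun b =>
  if [forall j : 'I_n, (j < i)%N ==> (b j == 0%N)] then s (b + U_(i))%MM else 0).
have qN i : 'm^N (q i).
  apply: IHN => b ltbN /=; case: ifP => // _; apply: s_lt.
  by rewrite mdegD mdeg1 addn1.
have -> : s = \sum_i mps_mon U_(i) * q i.
  apply/mpsP => c; rewrite mps_sumE.
  have coefMU i : (mps_mon U_(i) * q i) c =
      if (0 < c i)%N && [forall j : 'I_n, (j < i)%N ==> (c j == 0%N)]
      then s c else 0.
    rewrite mpsME; have [ci_gt0|] := ltnP 0 (c i); last first.
      rewrite leqn0 => /eqP ci0 /=; apply: big1 => a le_ac /=.
      case: eqP => [aE|]; last by rewrite mul0r.
      by move: le_ac => /mnm_lepP /(_ i); rewrite aE mnm1E eqxx ci0.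
    have le_ic : (U_(i) <= c)%MM by rewrite lep1mP -lt0n.
    have lt_ic : (mdeg U_(i)%MM < (mdeg c).+1)%N.
      by rewrite ltnS -(submK le_ic) mdegD leq_addl.
    rewrite (bigD1 (BMultinom lt_ic)) //= eqxx mul1r big1 => [|a]; last first.
      case/andP=> _ /eqP aN; case: eqP => [aE|]; last by rewrite mul0r.
      by case: aN; apply: val_inj.
    rewrite addr0 submK //; congr (if _ then _ else _).
    apply: eq_forallb => j; case: ltnP => //= lt_ji; congr (_ == _).
    by rewrite mnmBE mnm1E; case: eqP lt_ji => [->|_ _]; rewrite ?ltnn // subn0.
  under eq_bigr do rewrite coefMU.
  have [c0|/eqP c_neq0] := eqVneq c 0%MM.
    by rewrite big1 ?s_lt // ?c0 ?mdeg0 // => i _; rewrite mnm0E.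
  have [i0 ci0] : exists i, (0 < c i)%N.
    apply: contrapT => noi; apply: c_neq0; apply/mnmP => i; rewrite mnm0E.
    by apply/eqP; rewrite -leqn0 leqNgt; apply/negP => ci; apply: noi; exists i.
  (* The least variable occurring in [c] gives the only summand that can be nonzero. *)
  case: (arg_minnP (P := fun i => 0 < c i)%N (@nat_of_ord n) ci0) => i ci mini.
  rewrite (bigD1 i) //= ci big1 => [|j neq_ji] /=.
    rewrite addr0 ifT //; apply/forallP => j; apply/implyP => lt_ji.
    by rewrite -leqn0 leqNgt; apply/negP => /mini; rewrite leqNgt lt_ji.
  case: ifP => // /andP[cj /forallP /(_ i)].
  have lt_ij : (i < j)%N by rewrite ltn_neqAle mini // andbT eq_sym.
  by rewrite lt_ij /= -leqn0 leqNgt ci.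
exists [seq (mps_mon U_(i), q i) | i <- index_enum 'I_n].
  move=> _ /mapP[i _ ->]; split=> //=.
  by rewrite /mfrak /= eq_sym -mdeg_eq0 mdeg1.
by rewrite big_map.
Qed.

Lemma mpow_opp N s : 'm^N s -> 'm^N (- s).
Proof. by rewrite -mulrN1; apply: mpow_mull. Qed.

Definition mps_trunc N s : S := \sum_(a : 'X_{1..n < N}) s a *: mps_mon a.

Lemma mpow_subtrunc N s : 'm^N (s - mps_trunc N s).
Proof.
apply: mpow_coefP => b lt_bN; rewrite mpsDE mpsNE mps_sumE.
rewrite (bigD1 (BMultinom lt_bN)) //= eqxx mulr1 big1 ?addr0 ?subrr //.
move=> a /eqP neq_ab; case: eqP => [bE|]; last by rewrite mulr0.
by case: neq_ab; apply: val_inj.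
Qed.

(** Only finite sums pass through [F]; the tail, an element of ['m^N], is left to a continuity
    argument. *)
Lemma linear_trunc (V : lmodType k) (F : S -> V) N s :
  linear F -> F s = \sum_(a : 'X_{1..n < N}) s a *: F (mps_mon a)
    + F (s - mps_trunc N s).
Proof.
move=> linF.
have F0 : F 0 = 0.
  by apply: (addrI (F 0)); rewrite addr0 -[X in X + _]scale1r -linF scaler0 addr0.
have FD x y : F (x + y) = F x + F y by rewrite -[x]scale1r linF !scale1r.
have FZ (c : k) x : F (c *: x) = c *: F x by rewrite -[c *: x]addr0 linF F0 addr0.
have -> : F s = F (mps_trunc N s) + F (s - mps_trunc N s).
  by rewrite -FD addrCA subrr addr0.
apply: (congr1 (fun v => v + _)).
by rewrite (big_morph F FD F0); apply: eq_bigr => a _; rewrite FZ.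
Qed.

(** Lowering the order by at most one makes [F] m-adically continuous, so its values on monomials
    determine it. *)
Lemma linear_mon_eq0 (F : S -> S) :
  linear F -> (forall N s, 'm^N.+1 s -> 'm^N (F s)) ->
  (forall a, F (mps_mon a) = 0) -> forall s, F s = 0.
Proof.
(* The tail has order at least [(mdeg c).+2]; [F] loses one, and the coefficient at [c] still
   vanishes. *)
move=> linF Fm F0 s; apply/mpsP => c; rewrite (linear_trunc (mdeg c).+2 _ linF).
rewrite big1 => [|a _]; last by rewrite F0 scaler0.
by rewrite add0r; apply/(@mpow_coef _ _ (mdeg c).+1)/ltnSn/Fm/mpow_subtrunc.
Qed.

End OrderFiltration.

(** * Derivations of [S] as vector fields *)

Section Derivations.
Variables (n : nat) (k : fieldType).
Local Notation S := (mpseries n k).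
Implicit Types (s t : S) (a : 'X_{1..n}) (i : 'I_n) (b : 'I_n -> S).

Lemma mps_deriv_linear i : linear (@mps_deriv n k i).
Proof.
by move=> x s t; apply/mpsP => a; rewrite /= mulrDr mulrCA.
Qed.

Lemma mps_deriv_mpow i N s : 'm^N.+1 s -> 'm^N (mps_deriv i s).
Proof.
move=> Ns; apply: mpow_coefP => a lt_aN /=.
by rewrite (mpow_coef Ns) ?mulr0 // mdegD mdeg1 addn1.
Qed.

(** If [a i = 0], the truncated difference is [a] itself and the scalar is zero. *)
Lemma mps_deriv_mon i a :
  mps_deriv i (mps_mon a) = (a i)%:R *: mps_mon (a - U_(i))%MM :> S.
Proof.
apply/mpsP => c; rewrite mpsZE /=.
have [<-|neq_ca] := eqVneq (c + U_(i))%MM a.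
  by rewrite addmK eqxx mnmDE mnm1E eqxx addn1.
rewrite mulr0; case: eqP => [cE|_]; last by rewrite mulr0.
have [ai0|ai] := posnP (a i); first by rewrite ai0 mul0r.
by case/eqP: neq_ca; rewrite cE submK // lep1mP -lt0n.
Qed.

Lemma mps_derivM i s t :
  mps_deriv i (s * t) = s * mps_deriv i t + mps_deriv i s * t.
Proof.
(* The defect [E] is bilinear and m-adically continuous. *)
pose E s t := mps_deriv i (s * t) - (s * mps_deriv i t + mps_deriv i s * t).
have EC s1 t1 : E s1 t1 = E t1 s1.
  by rewrite /E mulrC [s1 * _]mulrC [_ * t1]mulrC [X in _ - X]addrC.
have linE t1 : linear (E^~ t1).
  move=> x u v; rewrite /E !mulrDl -!scalerAl !mps_deriv_linear !mulrDl -!scalerAl.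
  by rewrite addrACA -scalerDr scalerBr opprD addrACA.
have Em t1 N u : 'm^N.+1 u -> 'm^N (E u t1).
  move=> Nu; apply: mpow_add; first exact/mps_deriv_mpow/mpow_mull.
  apply/mpow_opp/mpow_add; last exact/mpow_mull/mps_deriv_mpow.
  exact/mpow_mull/(mpow_anti (leqnSn N)).
(* On monomials the rule amounts to [(a + b) i = a i + b i]. *)
have Emon (a b : 'X_{1..n}) : E (mps_mon a) (mps_mon b) = 0.
  rewrite /E mps_monM !mps_deriv_mon -scalerAr -scalerAl !mps_monM.
  apply/eqP; rewrite subr_eq0 mnmDE natrD scalerDl addrC; apply/eqP.
  congr (_ + _).
    have [->|bi] := posnP (b i); first by rewrite !scale0r.
    by rewrite addmBA // lep1mP -lt0n.
  have [->|ai] := posnP (a i); first by rewrite !scale0r.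
  by rewrite [(a - _ + b)%MM]addmC [(a + b)%MM]addmC addmBA // lep1mP -lt0n.
apply/eqP; rewrite -subr_eq0; apply/eqP.
(* The first argument is reduced to a monomial, then, by symmetry of [E], the second. *)
apply: (linear_mon_eq0 (linE t) (Em t)) => a; rewrite [LHS]EC.
exact: (linear_mon_eq0 (linE _) (Em _)).
Qed.

Lemma derivation0 (D : S -> S) : derivation D -> D 0 = 0.
Proof. by case=> _ /(_ 0 0); rewrite !mul0r mulr0 addr0. Qed.

Lemma derivationD (D : S -> S) s t : derivation D -> D (s + t) = D s + D t.
Proof. by case=> linD _; rewrite -[s]scale1r linD !scale1r. Qed.

(** Leibniz on a product of [N.+1] factors in [mfrak] spoils only one factor per term, so every
    derivation is continuous. *)
Lemma derivation_mpow (D : S -> S) N s :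
  derivation D -> 'm^N.+1 s -> 'm^N (D s).
Proof.
move=> derD; elim: N s => [//|N IHN] _ [r rI ->].
have DD x y : D (x + y) = D x + D y := derivationD x y derD.
rewrite (big_morph D DD (derivation0 derD)).
apply: mpow_sum => p /rI[mp Np]; rewrite derD.2; apply: mpow_add.
  exists [:: (p.1, D p.2)]; last by rewrite big_seq1.
  by move=> q; rewrite inE => /eqP ->; split=> //; apply: IHN.
by rewrite mulrC; apply: mpow_mull.
Qed.

(** By continuity monomials suffice, and Leibniz builds them from the variables and 1. *)
Lemma derivation_eq0 (D : S -> S) :
  derivation D -> (forall i, D (mps_mon U_(i)%MM) = 0) -> forall s, D s = 0.
Proof.
move=> derD DU; apply: (linear_mon_eq0 derD.1) => [N s|a].
  exact: derivation_mpow.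
move: {2}(mdeg a) (erefl (mdeg a)) => d; elim: d a => [|d IHd] a da.
  have -> : a = 0%MM by apply/eqP; rewrite -mdeg_eq0 da.
  (* [D 1 = D 1 + D 1] forces [D 1 = 0]. *)
  have := derD.2 1 1; rewrite !mul1r mulr1 => /esym/eqP.
  by rewrite -subr_eq0 addrK => /eqP.
have [i ai] : exists i, (0 < a i)%N.
  apply: contrapT => noi; move: da; rewrite mdegE big1 // => i _.
  by apply/eqP; rewrite -leqn0 leqNgt; apply/negP => ai; apply: noi; exists i.
have le_ia : (U_(i) <= a)%MM by rewrite lep1mP -lt0n.
rewrite -(submK le_ia) -mps_monM derD.2 DU mulr0 add0r IHd ?mul0r //.
by apply/eqP; rewrite -eqSS -da -{2}(submK le_ia) mdegD mdeg1 addn1.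
Qed.

Definition vfield b s : S := \sum_i b i * mps_deriv i s.

Lemma vfield_derivation b : derivation (vfield b).
Proof.
split=> [x s t|s t].
  rewrite /vfield scaler_sumr -big_split /=; apply: eq_bigr => i _.
  by rewrite mps_deriv_linear mulrDr -scalerAr.
rewrite /vfield mulr_sumr mulr_suml -big_split /=; apply: eq_bigr => i _.
by rewrite mps_derivM mulrDr mulrCA [X in _ + X]mulrA.
Qed.

Lemma vfieldU b i : vfield b (mps_mon U_(i)%MM) = b i.
Proof.
rewrite /vfield (bigD1 i) //= mps_deriv_mon mnm1E eqxx scale1r.
have -> : (U_(i) - U_(i))%MM = 0%MM by rewrite -{1}[U_(i)%MM]add0m addmK.
rewrite [mps_mon _]/(1 : S) mulr1 big1 ?addr0 // => j neq_ji.
by rewrite mps_deriv_mon mnm1E eq_sym (negPf neq_ji) scale0r mulr0.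
Qed.

Lemma derivation_vfield (D : S -> S) :
  derivation D -> D = vfield (fun i => D (mps_mon U_(i)%MM)).
Proof.
move=> derD; set b := fun i => _; have derV := vfield_derivation b.
apply/funext => s; apply/eqP; rewrite -subr_eq0; apply/eqP.
move: s; apply: (@derivation_eq0 (fun s => D s - vfield b s)) => [|i].
  split=> [x s t|s t]; first by rewrite derD.1 derV.1 scalerBr opprD addrACA.
  by rewrite derD.2 derV.2 mulrBr mulrBl opprD addrACA.
by rewrite vfieldU subrr.
Qed.

Lemma mfrakU i : mfrak (mps_mon U_(i)%MM : S).
Proof. by rewrite /mfrak /= eq_sym -mdeg_eq0 mdeg1. Qed.

Lemma mpow1_mfrak s : 'm^1 s -> mfrak s.
Proof. by move=> /mpow_coef; apply; rewrite mdeg0. Qed.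

Lemma mfrakN s : mfrak s -> mfrak (- s).
Proof. by move=> /mpow1/mpow_opp/mpow1_mfrak. Qed.

Lemma mfrakD s t : mfrak s -> mfrak t -> mfrak (s + t).
Proof. by move=> /mpow1 s1 /mpow1 t1; apply/mpow1_mfrak/mpow_add. Qed.

(** The sum is the divergence of the vector field [b], the correction term in [vfield_dual]; each
    derivative loses one order. *)
Lemma mfrak_div b :
  (forall i, 'm^2 (b i)) -> mfrak (\sum_i mps_deriv i (b i)).
Proof.
by move=> b2; apply/mpow1_mfrak/mpow_sum => i _; apply: mps_deriv_mpow.
Qed.

(** The condition on [D] becomes one on the [b i]: evaluate at the variables one way, use that
    ['m^2] is an ideal the other way. *)
Lemma gfrakpP (L : S -> S) :
  gfrakp L <-> exists b s, [/\ forall i, 'm^2 (b i), mfrak s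
    & L = fun t => vfield b t + s * t].
Proof.
split=> [[D [derD Dm] [s ms <-]]|[b [s [b2 ms ->]]]].
  exists (fun i => D (mps_mon U_(i)%MM)), s; split=> // [i|].
    by apply: Dm; exists (mps_mon U_(i)%MM) => //; apply: mfrakU.
  by rewrite -derivation_vfield.
exists (vfield b); last by exists s.
split; first exact: vfield_derivation.
by move=> _ [t _ <-]; apply: mpow_sum => i _; apply: mpow_mull.
Qed.

Lemma gfrakE (L : S -> S) :
  gfrak L -> exists b s, L = fun t => vfield b t + s * t.
Proof.
move=> [D [derD _] [s _ <-]].
by exists (fun i => D (mps_mon U_(i)%MM)), s; rewrite -derivation_vfield.
Qed.

End Derivations.

(** * Coefficients, degrees and multiplication by [x_i] in terms of the pairing *)

Section Pairing.
Variables (n : nat) (k : fieldType).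
Local Notation S := (mpseries n k).
Implicit Types (s t : S) (a b c : 'X_{1..n}) (i : 'I_n) (f g h : dpoly n k).

Lemma pairing0l f : <|0, f|> = 0.
Proof. by rewrite -(subrr 0) -scaleN1r addrC pairing_linear scaleN1r addNr. Qed.

Lemma pairingDl s t f : <|s + t, f|> = <|s, f|> + <|t, f|>.
Proof. by rewrite -[s]scale1r pairing_linear !scale1r. Qed.

Lemma pairingZl x s f : <|x *: s, f|> = x * <|s, f|>.
Proof. by rewrite -[x *: s]addr0 pairing_linear pairing0l addr0. Qed.

Lemma pairing_suml (I : Type) (r : seq I) (F : I -> S) f :
  <|\sum_(i <- r) F i, f|> = \sum_(i <- r) <|F i, f|>.
Proof.
apply: (big_morph (fun s => <|s, f|>)) => [s t|]; first exact: pairingDl.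
exact: pairing0l.
Qed.

Lemma pairing_sumr (I : Type) (r : seq I) (F : I -> dpoly n k) s :
  <|s, \sum_(i <- r) F i|> = \sum_(i <- r) <|s, F i|>.
Proof. exact: (big_morph (fun f => <|s, f|>)). Qed.

Lemma pairing_contr s t f : <|t, contr s f|> = <|t * s, f|>.
Proof. by []. Qed.

(** As [f] kills some ['m^N], the pairing is a finite sum of terms [s a * dpcoef f a]. *)
Lemma pairing_coef_eq0 s f :
  (forall a, s a * dpcoef f a = 0) -> <|s, f|> = 0.
Proof.
move=> sf0; have [N fN] := pairing_mpow f.
rewrite (linear_trunc N s (pairing_linear f)).
rewrite fN ?addr0; last exact: mpow_subtrunc.
by apply: big1 => a _; exact: sf0.
Qed.

Lemma dpcoef_inj f g : (forall a, dpcoef f a = dpcoef g a) -> f = g.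
Proof.
move=> fg; apply: dpolyP => s; apply/eqP; rewrite -subr_eq0; apply/eqP.
rewrite -[RHS](@pairing_coef_eq0 s (f - g)) // => a.
rewrite /dpcoef -scaleN1r pairingD pairingZ mulN1r.
by rewrite [<|_, f|>]fg subrr mulr0.
Qed.

(** The tail of [s], multiplied by any [t], stays in a power of [mfrak] killed by [f]. *)
Lemma contr_trunc s f : exists N,
  contr s f = \sum_(a : 'X_{1..n < N}) s a *: contr (mps_mon a) f.
Proof.
have [N fN] := pairing_mpow f; exists N; apply: dpolyP => t.
rewrite pairing_sumr pairing_contr -{1}[s](subrK (mps_trunc N s)) mulrDr pairingDl.
rewrite fN ?add0r; last by rewrite mulrC; apply/mpow_mull/mpow_subtrunc.
rewrite mulr_sumr pairing_suml; apply: eq_bigr => a _.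
by rewrite -scalerAr pairingZl pairingZ.
Qed.

Lemma dpsize_leP f e :
  (dpsize f <= e)%N <-> forall s, 'm^e s -> <|s, f|> = 0.
Proof.
rewrite /dpsize; case: ex_minnP => N /asboolP fN minN; split=> [leNe s es|fe].
  apply: pairing_coef_eq0 => a; have [/(mpow_coef es) ->|le_ea] := ltnP (mdeg a) e.
    by rewrite mul0r.
  by rewrite fN ?mulr0 // (leq_trans leNe).
by apply/minN/asboolP => a le_ea; apply/fe/mps_mon_mpow.
Qed.

(** Makes degree bounds testable on powers of [mfrak]; the shift by one comes from [dpdeg] being
    [dpsize - 1]. *)
Lemma dpdeg_leP f (e : nat) :
  dpdeg f <= e <-> forall s, 'm^(e.+1) s -> <|s, f|> = 0.
Proof.
by rewrite -dpsize_leP /dpdeg lerBlDr -PoszD addn1.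
Qed.

Fact dpderiv_proof i f : in_P (fun s => <|mps_deriv i s, f|>).
Proof.
apply/asboolP; split=> [x s t|].
  by rewrite mps_deriv_linear pairing_linear.
by have [N fN] := pairing_mpow f; exists N.+1 => s /mps_deriv_mpow/fN.
Qed.

(** On bases, [x_i x^[b] = (b_i + 1) x^[b + e_i]] mirrors the derivative of the monomial with
    exponent [b + e_i]. *)
Lemma pairing_dpvarM i f s : <|s, dpmul (dpvar i) f|> = <|mps_deriv i s, f|>.
Proof.
suff -> : dpmul (dpvar i) f = DPoly (dpderiv_proof i f) by [].
apply: dpcoef_inj => c.
rewrite [RHS]/dpcoef [RHS]/pairing /= mps_deriv_mon pairingZl.
rewrite [LHS]/dpcoef /dpmul pairing_sumr -/(dpcoef f _).
have coefx a : dpcoef (dpvar i) a = (U_(i)%MM == a)%:R :> k by [].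
(* [dpvar i] does not vanish on ['m^1], so [U_(i)] is in the range of the outer sum. *)
have lt_i : (mdeg U_(i)%MM < dpsize (dpvar i : dpoly n k))%N.
  rewrite ltnNge; apply/negP => /dpsize_leP/(_ _ (mps_mon_mpow _ (leqnn _)))/eqP.
  by rewrite [X in X == 0]coefx eqxx oner_eq0.
rewrite (bigD1 (BMultinom lt_i)) //= [X in _ + X]big1 ?addr0; last first.
  move=> a /eqP neq_ai; apply: etrans (pairing_sumr _ _ _) _.
  apply: big1 => b _.
  case: eqP => [aE|]; last by rewrite !mul0r scale0r pairing0.
  by case: neq_ai; apply: val_inj.
rewrite eqxx pairing_sumr.
(* Only [b = c - U_(i)] survives, with binomial factor ['C(1 + b i, 1) = c i]. *)
have termE b : <|mps_mon c, (true%:R * dpcoef f b *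
    (\prod_j 'C(U_(i)%MM j + b j, U_(i)%MM j))%:R) *: dpmon (U_(i) + b)%MM|> =
    (if (U_(i) + b)%MM == c then (c i)%:R * dpcoef f (c - U_(i))%MM else 0).
  rewrite pairingZ [<|_, _|>]/(((U_(i) + b)%MM == c)%:R).
  case: eqP => [<-|_]; last by rewrite mulr0.
  rewrite mulr1 mul1r mulrC [(U_(i) + b)%MM]addmC addmK.
  congr (_%:R * _); rewrite mnmDE mnm1E eqxx addnC (bigD1 i) //= mnm1E eqxx bin1.
  rewrite big1 ?muln1 // => j neq_ji.
  by rewrite mnm1E eq_sym (negPf neq_ji) bin0.
under eq_bigr do rewrite termE.
have [ci0|ci] := posnP (c i).
  by rewrite ci0 mul0r big1 // => b _; rewrite if_same.
have le_ic : (U_(i) <= c)%MM by rewrite lep1mP -lt0n.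
have eqUc (b : 'X_{1..n}) : ((U_(i) + b)%MM == c) = (b == c - U_(i))%MM.
  by rewrite -{1}(submK le_ic) addmC eqm_add2r.
under eq_bigr do rewrite eqUc.
(* Beyond the range of the inner sum the coefficient of [f] is zero, so both sides vanish. *)
have [lt_cf|le_fc] := ltnP (mdeg (c - U_(i))%MM) (dpsize f).
  rewrite (bigD1 (BMultinom lt_cf)) //= eqxx big1 ?addr0 // => b /eqP neq_bc.
  by case: eqP => // bE; case: neq_bc; apply: val_inj.
rewrite big1 => [|b _]; last first.
  by case: eqP => // bE; have := bmdeg b; rewrite bE ltnNge le_fc.
have /dpsize_leP/(_ _ (mps_mon_mpow _ le_fc)) := leqnn (dpsize f).
by rewrite -/(dpcoef f _) => ->; rewrite mulr0.
Qed.

(** This contraction is dual to multiplying by [s] and then differentiating; Leibniz expands it. *)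
Lemma pairing_contr_dpvarM i s t f :
  <|t, contr s (dpmul (dpvar i) f)|> =
  <|s * mps_deriv i t + mps_deriv i s * t, f|>.
Proof.
by rewrite pairing_contr pairing_dpvarM mps_derivM addrC [_ * s]mulrC [t * _]mulrC.
Qed.

End Pairing.

(** * The space [g^+ f] and its annihilator *)

Section TangentSpace.
Variables (n : nat) (k : fieldType).
Local Notation S := (mpseries n k).
Implicit Types (s t u : S) (a c : 'X_{1..n}) (i : 'I_n) (f g h : dpoly n k).
Implicit Types (b : 'I_n -> S) (x : k).

(** Summing [pairing_contr_dpvarM] over [i] yields the vector field plus multiplication by the
    divergence of [b], which the first contraction subtracts. *)
Lemma vfield_dual b s f :
  is_dual (fun t => vfield b t + s * t) f
    (contr (s - \sum_i mps_deriv i (b i)) f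
       + \sum_i contr (b i) (dpmul (dpvar i) f)).
Proof.
move=> t; rewrite pairingD pairing_sumr pairing_contr.
under [X in _ + X]eq_bigr do rewrite pairing_contr_dpvarM pairingDl.
rewrite big_split /= -!pairing_suml -mulr_suml -/(vfield b t).
rewrite addrCA -!pairingDl; congr (<|_ + _, f|>).
by rewrite mulrBr [t * _]mulrC [t * _]mulrC subrK.
Qed.

(** For fixed [b] in ['m^2], shifting [s] by the divergence of [b] is a bijection of [mfrak]. *)
Lemma act_gfrakpE f :
  act_set gfrakp f =
    set_add (contr_set mfrak f)
      (set_bigsum (fun i : 'I_n =>
         contr_set (ideal_pow mfrak 2) (dpmul (dpvar i) f))).
Proof.
apply/seteqP; split=> [g [L /gfrakpP[b [s [b2 ms ->]]] fg]|].
  rewrite (is_dual_inj fg (vfield_dual b s f)).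
  exists (contr (s - \sum_i mps_deriv i (b i)) f).
    exists (s - \sum_i mps_deriv i (b i)) => //.
    by apply: mfrakD => //; apply/mfrakN/mfrak_div.
  exists (\sum_i contr (b i) (dpmul (dpvar i) f)) => //.
  by exists (fun i => contr (b i) (dpmul (dpvar i) f)) => // i; exists (b i).
move=> _ [_ [u mu <-] [_ [w wP <-] <-]].
have /boolp.choice[b bP] : forall i, exists s,
    'm^2 s /\ contr s (dpmul (dpvar i) f) = w i.
  by move=> i; have [s s2 <-] := wP i; exists s.
exists (fun t => vfield b t + (u + \sum_i mps_deriv i (b i)) * t).
  apply/gfrakpP; exists b, (u + \sum_i mps_deriv i (b i)).
  by split=> // [i|]; [case: (bP i)|apply/mfrakD/mfrak_div => // i; case: (bP i)].
have := vfield_dual b (u + \sum_i mps_deriv i (b i)) f; rewrite addrK.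
by under [X in contr u f + X]eq_bigr => i _ do rewrite (bP i).2.
Qed.

(** Each [L] in [G] has a dual, so orthogonality can be tested on operators. *)
Lemma perp_actP (G : set (S -> S)) f s : G `<=` gfrak ->
  perp (act_set G f) s <-> forall L, G L -> <|L s, f|> = 0.
Proof.
move=> Gg; split=> [sP L GL|sP w [L GL fw]]; last by rewrite fw sP.
by have [g fg] := dual_exists f (Gg L GL); rewrite -fg; apply: sP; exists L.
Qed.

Definition single i s : 'I_n -> S := fun j => if j == i then s else 0.

Lemma vfield_single i s t : vfield (single i s) t = s * mps_deriv i t.
Proof.
rewrite /vfield (bigD1 i) //= /single eqxx big1 ?addr0 // => j /negPf ->.
by rewrite mul0r.
Qed.

Lemma gfrakp_mul u : mfrak u -> gfrakp (fun t : S => u * t).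
Proof.
move=> mu; apply/gfrakpP; exists (fun=> 0), u; split=> // [i|]; first exact: mpow0.
by apply/funext => t; rewrite /vfield big1 ?add0r // => i _; rewrite mul0r.
Qed.

Lemma gfrakp_deriv i s u :
  'm^2 s -> mfrak u -> gfrakp (fun t => s * mps_deriv i t + u * t).
Proof.
move=> s2 mu; apply/gfrakpP; exists (single i s), u; split=> // [j|].
  by rewrite /single; case: ifP => _ //; apply: mpow0.
by apply/funext => t; rewrite vfield_single.
Qed.

(** By [<|u * s, f|> = <|u, contr s f|>], multiplications by [u] in [mfrak] test the first bound and
    the fields [u d_i] with [u] in ['m^2] the others. *)
Lemma perp_act_gfrakpE f :
  perp (act_set gfrakp f) =
    [set s : S | dpdeg (contr s f) <= 0 /\
       forall i : 'I_n, dpdeg (contr (mps_deriv i s) f) <= 1].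
Proof.
apply/seteqP; split=> s.
  move=> /(perp_actP _ _ (@gfrakp_sub n k)) sP; split=> [|i].
    by apply/(dpdeg_leP _ 0) => u /mpow1_mfrak/gfrakp_mul/sP.
  apply/(dpdeg_leP _ 1) => u u2.
  have /sP : gfrakp (fun t => u * mps_deriv i t + 0 * t) by apply: gfrakp_deriv.
  by rewrite mul0r addr0.
move=> [/(dpdeg_leP _ 0) s0 s1].
apply/(perp_actP _ _ (@gfrakp_sub n k)) => _ /gfrakpP[b [u [b2 mu ->]]].
rewrite pairingDl pairing_suml big1 => [|i _]; last first.
  by have /(dpdeg_leP _ 1) := s1 i; apply.
by rewrite add0r; apply: s0; apply: mpow1.
Qed.

(** * Linear spans and the homogeneous case *)

Section Span.
Variable H : set (dpoly n k).

Lemma span_mem h : H h -> span_set H h.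
Proof.
move=> Hh; exists [:: (1, h)]; last by rewrite big_seq1 scale1r.
by move=> p; rewrite inE => /eqP ->.
Qed.

Lemma span0 : span_set H 0.
Proof. by exists [::]; rewrite ?big_nil. Qed.

Lemma spanD g h : span_set H g -> span_set H h -> span_set H (g + h).
Proof.
move=> [r rH ->] [r' rH' ->]; exists (r ++ r'); last by rewrite big_cat.
by move=> p; rewrite mem_cat => /orP[/rH|/rH'].
Qed.

Lemma spanZ x h : span_set H h -> span_set H (x *: h).
Proof.
move=> [r rH ->]; exists [seq (x * p.1, p.2) | p <- r].
  by move=> _ /mapP[p /rH Hp ->].
by rewrite big_map scaler_sumr; apply: eq_bigr => p _; rewrite scalerA.
Qed.

Lemma span_sum (I : Type) (r : seq I) (F : I -> dpoly n k) :
  (forall j, span_set H (F j)) -> span_set H (\sum_(j <- r) F j).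
Proof.
by move=> FH; elim/big_rec: _ => [|j y _]; [exact: span0|apply: spanD].
Qed.

Lemma span_contr u h :
  (forall a, u a != 0 -> H (contr (mps_mon a) h)) -> span_set H (contr u h).
Proof.
move=> uH; have [N ->] := contr_trunc u h; apply: span_sum => a.
have [->|ua] := eqVneq (u a) 0; first by rewrite scale0r; exact: span0.
by apply/spanZ/span_mem/uH.
Qed.

End Span.

(** [g^+ f] is a subspace: the data [b], [s] of [gfrakpP] combine linearly. *)
Lemma act_gfrakp_sub H f :
  H `<=` act_set gfrakp f -> span_set H `<=` act_set gfrakp f.
Proof.
move=> Hf _ [r rH ->]; rewrite big_seq.
elim/big_rec: _ => [|p g pr [L /gfrakpP[b [s [b2 ms ->]]] fg]].
  exists (fun t => 0 * t); first exact: gfrakp_mul.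
  by move=> t; rewrite mul0r pairing0l.
have [L' /gfrakpP[b' [s' [b2' ms' ->]]] fg'] := Hf _ (rH _ pr).
exists (fun t => vfield (fun i => p.1 *: b' i + b i) t + (p.1 *: s' + s) * t).
  (* Writing a scalar as a series lets the ideal property apply. *)
  have scaleE t : p.1 *: t = t * (p.1 *: 1) by rewrite -scalerAr mulr1.
  apply/gfrakpP; exists (fun i => p.1 *: b' i + b i), (p.1 *: s' + s).
  split=> // [i|].
    by apply: mpow_add => //; rewrite scaleE; apply: mpow_mull.
  by apply: mfrakD => //; rewrite scaleE; apply: mfrak_mull.
move=> t; rewrite pairingD pairingZ fg fg' -pairingZl -pairingDl.
congr (<|_, f|>); rewrite scalerDr addrACA mulrDl -scalerAl; congr (_ + _).
rewrite /vfield scaler_sumr -big_split /=; apply: eq_bigr => i _.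
by rewrite mulrDl -scalerAl.
Qed.

(** For [mdeg a > d] the contraction is zero, hence homogeneous of every degree, and the truncated
    subtraction is harmless. *)
Lemma dphomog_contr d f a :
  dphomog d f -> dphomog (d - mdeg a)%N (contr (mps_mon a) f).
Proof.
move=> fd c; rewrite /dpcoef pairing_contr mps_monM => /fd <-.
by rewrite mdegD addnK.
Qed.

Lemma dphomog_dpvarM d f i : dphomog d f -> dphomog d.+1 (dpmul (dpvar i) f).
Proof.
move=> fd c; rewrite /dpcoef pairing_dpvarM mps_deriv_mon pairingZl.
rewrite mulf_eq0 negb_or => /andP[ci /fd <-].
have le_ic : (U_(i) <= c)%MM by rewrite lep1mP; apply: contraNneq ci => ->.
by rewrite -{1}(submK le_ic) mdegD mdeg1 addn1.
Qed.

(** All homogeneous elements of [g^+ f] serve as [H]: monomials occurring in elements of [mfrak] or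
    ['m^2] lie there themselves, and contraction by them preserves homogeneity. *)
Lemma act_gfrakp_homog d f : dphomog d f ->
  exists2 H : set (dpoly n k),
    (forall h, H h -> exists e : nat, dphomog e h)
    & act_set gfrakp f = span_set H.
Proof.
move=> fd; exists [set h | act_set gfrakp f h /\ exists e, dphomog e h].
  by move=> h [].
apply/seteqP; split; last by apply: act_gfrakp_sub => h [].
rewrite {1}act_gfrakpE => _ [_ [u mu <-] [_ [w wP <-] <-]].
apply: spanD; last apply: span_sum => i.
  apply: span_contr => a ua; split; last first.
    by exists (d - mdeg a)%N; apply: dphomog_contr.
  exists (fun t => mps_mon a * t); last by move=> t; rewrite pairing_contr mulrC.
  apply/gfrakp_mul/mpow1_mfrak/mps_mon_mpow; rewrite lt0n mdeg_eq0.
  by apply: contraNneq ua => ->; rewrite mu.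
have [s s2 <-] := wP i; apply: span_contr => a sa; split; last first.
  by exists (d.+1 - mdeg a)%N; apply/dphomog_contr/dphomog_dpvarM.
have a2 : 'm^2 (mps_mon a : S).
  apply: mps_mon_mpow; rewrite leqNgt; apply: contraNN sa => lt_a2.
  by rewrite (mpow_coef s2).
(* The second term is the divergence of the first; it makes the dual exactly the contraction of
   [x_i f]. *)
exists (fun t => mps_mon a * mps_deriv i t + mps_deriv i (mps_mon a) * t).
  by apply: gfrakp_deriv => //; apply/mpow1_mfrak/mps_deriv_mpow.
by move=> t; rewrite pairing_contr_dpvarM.
Qed.

(** No monomial occurs in both. *)
Lemma pairing_lt_homog d f s : dphomog d f -> mps_lt d s -> <|s, f|> = 0.
Proof.
move=> fd sd; apply: pairing_coef_eq0 => a.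
have [->|/fd da] := eqVneq (dpcoef f a) 0; first by rewrite mulr0.
by rewrite sd ?mul0r // da.
Qed.

(** The degree lost by differentiating pays for the monomial. *)
Lemma mps_lt_monM_deriv d a i s :
  (mdeg a <= 1)%N -> mps_lt d s -> mps_lt d (mps_mon a * mps_deriv i s).
Proof.
move=> le_a1 sd c le_dc; rewrite mpsME big1 // => a' le_ac /=.
case: eqP => [aE|_]; last by rewrite mul0r.
rewrite sd ?mulr0 // mdegD mdeg1 addn1 (leq_trans le_dc) //.
by rewrite aE in le_ac *; rewrite -{1}(submK le_ac) mdegD -addn1 leq_add2l.
Qed.

(** The bound leaves only the constant coefficient, which is [<|s, f|>]. *)
Lemma contr_lt_homog d f s : dphomog d f -> mps_lt d s ->
  dpdeg (contr s f) <= 0 -> contr s f = 0.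
Proof.
move=> fd sd /(dpdeg_leP _ 0) s0; apply: dpcoef_inj => a.
have [->|a_neq0] := eqVneq a 0%MM.
  by rewrite [LHS]pairing_contr [mps_mon _]/(1 : S) mul1r (pairing_lt_homog fd sd).
by apply/s0/mps_mon_mpow; rewrite lt0n mdeg_eq0.
Qed.

(** The coefficients left, in degrees at most 1, pair [f] with polynomials still of degree less than
    [d]. *)
Lemma contr_deriv_lt_homog d f s i : dphomog d f -> mps_lt d s ->
  dpdeg (contr (mps_deriv i s) f) <= 1 -> contr (mps_deriv i s) f = 0.
Proof.
move=> fd sd /(dpdeg_leP _ 1) s1; apply: dpcoef_inj => a.
have [le_a1|lt_1a] := leqP (mdeg a) 1; last exact/s1/mps_mon_mpow.
exact/(pairing_lt_homog fd)/mps_lt_monM_deriv.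
Qed.

End TangentSpace.

(** * Comparison of the annihilators of [g f] and [g^+ f] below degree [d] *)

Theorem proposition2p20 (k : closedFieldType) (n : nat) (f : dpoly n k) :
  [/\ act_set gfrakp f =
        set_add (contr_set mfrak f)
          (set_bigsum (fun i : 'I_n =>
             contr_set (ideal_pow mfrak 2) (dpmul (dpvar i) f))),
      perp (act_set gfrakp f) =
        [set s : mpseries n k | dpdeg (contr s f) <= 0 /\
           forall i : 'I_n, dpdeg (contr (mps_deriv i s) f) <= 1]
    & forall d : nat, dphomog d f ->
      [/\ exists2 H : set (dpoly n k),
            (forall h, H h -> exists e : nat, dphomog e h)
            & act_set gfrakp f = span_set H,
          perp (act_set gfrakp f) `&` mps_lt d =
            [set s : mpseries n k | mps_lt d s /\ contr s f = 0 /\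
               forall i : 'I_n, contr (mps_deriv i s) f = 0]
        & [set s : mpseries n k | mps_lt d s /\ contr s f = 0 /\
             forall i : 'I_n, contr (mps_deriv i s) f = 0] =
            perp (act_set gfrak f) `&` mps_lt d]].
Proof.
split=> [||d fd]; first exact: act_gfrakpE.
  exact: perp_act_gfrakpE.
set K := [set s | _].
(* A cycle of inclusions, below degree [d]: the annihilator of [g^+ f] in [K], [K] in that of [g f],
   and that in the first. *)
have perpK : perp (act_set gfrakp f) `&` mps_lt d `<=` K.
  move=> s [] /[swap] sd; rewrite perp_act_gfrakpE => -[s0 s1]; split=> //.
  split=> [|i]; first exact: contr_lt_homog fd sd s0.
  exact: contr_deriv_lt_homog fd sd (s1 i).
have Kperp : K `<=` perp (act_set gfrak f) `&` mps_lt d.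
  move=> s [sd [s0 s1]]; split=> //.
  apply/perp_actP => // _ /gfrakE[b [u ->]].
  rewrite pairingDl pairing_suml -pairing_contr s0 addr0.
  by apply: big1 => i _; rewrite -pairing_contr s1.
have gperp : perp (act_set gfrak f) `<=` perp (act_set gfrakp f).
  by move=> s sP w [L /gfrakp_sub gL fw]; apply: sP; exists L.
split; first exact: act_gfrakp_homog fd.
  apply/seteqP; split=> // s /Kperp[/gperp sP sd]; split=> //.
by apply/seteqP; split=> // s [/gperp sP sd]; apply: perpK.
Qed.
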